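(* Let $G=(V,E)$ be a finite sober connected graph with $\mathrm{c\text{-}rk}\,G=3$, and let $W\subseteq V$. Then $W$ is c-independent if and only if either $|W|\le 2$, or $|W|=3$, $\mathrm{St}(W)=\emptyset$ and $W$ is not a potential line.
   Context: Graphs are finite, undirected, without loops or multiple edges. $\mathrm{St}(v)$ is the set of vertices adjacent to $v$; $\mathrm{St}(W)=\bigcap_{w\in W}\mathrm{St}(w)$. $G$ is sober if the map $v\mapsto\mathrm{St}(v)$ is injective. $A^c$ is the $V\times V$ boolean matrix with $(i,j)$ entry $0$ if $\{i,j\}\in E$ and $1$ otherwise. Over the superboolean semiring $\mathbb{SB}=\{0,1,1^\nu\}$ (addition $0+x=x$, $1+1=1^\nu$, $1^\nu+x=1^\nu$; multiplication $0\cdot x=0$, $1\cdot1=1$, $1\cdot1^\nu=1^\nu\cdot1^\nu=1^\nu$), vectors are dependent if some combination with coefficients in $\{0,1\}$, not all zero, has all coordinates in $\{0,1^\nu\}$, and independent otherwise. A set $W$ of vertices is c-independent if the columns of $A^c$ indexed by $W$ are independent; $\mathrm{c\text{-}rk}\,G$ is the maximum size of a c-independent set. A 3-subset $P\subseteq V$ is a potential line if $|P\cap\mathrm{St}(v)|\le1$ for every $v\in V$. *)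

(* Defs.v *)
From HB Require Import structures.
From mathcomp Require Import all_boot all_order all_algebra.

Set Implicit Arguments.
Unset Strict Implicit.
Unset Printing Implicit Defensive.

Import GRing.Theory.

(* The superboolean semiring {0, 1, 1^nu}; SBnu is the ghost element 1^nu. *)
Inductive SB := SB0 | SB1 | SBnu.

Definition SB_to_option (x : SB) : option bool :=
  match x with SB0 => None | SB1 => Some false | SBnu => Some true end.
Definition SB_of_option (o : option bool) : SB :=
  match o with None => SB0 | Some false => SB1 | Some true => SBnu end.

Lemma SB_to_optionK : cancel SB_to_option SB_of_option.
Proof. by case. Qed.

HB.instance Definition _ := Finite.copy SB (can_type SB_to_optionK).

Definition SB_add (x y : SB) : SB :=
  match x, y with
  | SB0, z | z, SB0 => z
  | _, _ => SBnu
  end.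

Definition SB_mul (x y : SB) : SB :=
  match x, y with
  | SB0, _ | _, SB0 => SB0
  | SB1, SB1 => SB1
  | _, _ => SBnu
  end.

Lemma SB_addA : associative SB_add. Proof. by do 3!case. Qed.
Lemma SB_addC : commutative SB_add. Proof. by do 2!case. Qed.
Lemma SB_add0 : left_id SB0 SB_add. Proof. by case. Qed.
Lemma SB_mulA : associative SB_mul. Proof. by do 3!case. Qed.
Lemma SB_mulC : commutative SB_mul. Proof. by do 2!case. Qed.
Lemma SB_mul1 : left_id SB1 SB_mul. Proof. by case. Qed.
Lemma SB_mulDl : left_distributive SB_mul SB_add. Proof. by do 3!case. Qed.
Lemma SB_mul0 : left_zero SB0 SB_mul. Proof. by case. Qed.
Lemma SB_1neq0 : SB1 != SB0. Proof. by []. Qed.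

HB.instance Definition _ := GRing.isNmodule.Build SB SB_addA SB_addC SB_add0.
HB.instance Definition _ := GRing.Nmodule_isComNzSemiRing.Build SB
  SB_mulA SB_mulC SB_mul1 SB_mulDl SB_mul0 SB_1neq0.

(* The family (v k) for k in W, of vectors with coordinates indexed by I. *)
Definition sb_dependent (K I : finType) (v : K -> I -> SB) (W : {set K}) : bool :=
  [exists c : {ffun K -> SB},
    [&& [forall k in W, c k \in [:: 0; 1]%R],
        [exists k in W, c k != 0%R] &
        [forall i : I, (\sum_(k in W) c k * v k i)%R \in [:: 0%R; SBnu]]]].

Definition sb_independent (K I : finType) (v : K -> I -> SB) (W : {set K}) : bool :=
  ~~ sb_dependent v W.

(* A graph on the vertex type T is given by its adjacency relation e. *)
Section Graph.
Variables (T : finType) (e : rel T).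

Definition simple_graph : Prop := symmetric e /\ irreflexive e.

Definition connected_graph : Prop := forall x y : T, connect e x y.

Definition star (v : T) : {set T} := [set w | e v w].

Definition star_set (W : {set T}) : {set T} := \bigcap_(w in W) star w.

Definition sober : Prop := injective star.

Definition compl_adj (i j : T) : SB := if e i j then 0%R else 1%R.

Definition c_independent (W : {set T}) : bool :=
  sb_independent (fun w i => compl_adj i w) W.

Definition c_rank : nat := \max_(W : {set T} | c_independent W) #|W|.

Definition potential_line (P : {set T}) : Prop :=
  #|P| = 3 /\ forall v : T, #|P :&: star v| <= 1.

End Graph.

(* Main.v *)
Require Import Defs.
From mathcomp Require Import all_boot all_order all_algebra.

(** A set is c-independent iff each of its nonempty subsets [X] is witnessed by
a vertex adjacent to all of [X] but one.  Singletons are witnessed by their own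
element and pairs by soberness, so only triples matter.  If a vertex [u] is
adjacent to all of a c-independent [W], then [u] itself witnesses every subset
of [W + u] containing [u], so [W + u] is c-independent: a triple with a common
neighbour contradicts rank 3. *)

(** From two summands on, a sum of ones is the ghost and stays there; only a single one gives a
    value outside $\{0, 1^\nu\}$. *)
Lemma SB_natr_in (n : nat) :
  ((1 : SB) *+ n \in [:: 0; SBnu])%R = (n != 1).
Proof.
case: n => [|[|n]] //; suff -> : ((1 : SB) *+ n.+2)%R = SBnu by [].
by elim: n => //= n IHn; rewrite GRing.mulrS IHn.
Qed.

Section CIndependence.
Variables (T : finType) (e : rel T).

Lemma sum_compl_adj (X : {set T}) (v : T) :
  (\sum_(k in X) compl_adj e v k)%R = ((1 : SB) *+ #|X :\: star e v|)%R.
Proof.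
rewrite -GRing.sumr_const (bigID (mem (star e v))) /= big1 ?GRing.add0r.
  apply: eq_big => k; first by rewrite !inE andbC.
  by rewrite inE /compl_adj => /andP[_ /negPf->].
by move=> k; rewrite inE /compl_adj => /andP[_ ->].
Qed.

(** A nonzero combination with coefficients 0 and 1 amounts to a nonempty subset [X]. Its coordinate
    at [v] adds a one for each element of [X] outside [star e v], hence lies outside $\{0, 1^\nu\}$
    exactly when one such element exists. *)
Lemma c_independentP (W : {set T}) :
  reflect (forall X : {set T}, X \subset W -> X != set0 ->
             exists v, #|X :\: star e v| = 1)
          (c_independent e W).
Proof.
apply: (iffP negP) => [indW X sXW /set0Pn[x Xx] | witW].
  apply/'exists_eqP; apply: contra_notT indW; rewrite negb_exists => /forallP noX.
  apply/existsP; exists [ffun k => if k \in X then SB1 else SB0].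
  apply/and3P; split.
  - by apply/forall_inP => k _; rewrite ffunE; case: ifP.
  - by apply/exists_inP; exists x; rewrite ?(subsetP sXW) // ffunE Xx.
  apply/forallP => v; rewrite [X in X \in _](_ : _ = (1 *+ #|X :\: star e v|)%R).
    by rewrite SB_natr_in; apply: contra (noX v) => /eqP->.
  rewrite -sum_compl_adj (big_setID X) /= (setIidPr sXW).
  rewrite [X in (_ + X)%R]big1 ?GRing.addr0 => [|k]; last first.
    by rewrite inE ffunE => /andP[/negPf-> _].
  by apply: eq_bigr => k Xk; rewrite ffunE Xk GRing.mul1r.
case/existsP=> c /and3P[/forall_inP c01 /exists_inP[x Wx cx] /forallP sumc].
(* On the support of [c] all coefficients are 1, so the coordinate at a witness of [X] would be
   1. *)
pose X := [set k in W | c k != 0%R].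
have sXW : X \subset W by apply/subsetP => k; rewrite inE => /andP[].
have [||v] := witW X => //; first by apply/set0Pn; exists x; rewrite inE Wx.
apply/eqP; rewrite -SB_natr_in -sum_compl_adj.
rewrite [X in X \in _](_ : _ = (\sum_(k in W) c k * compl_adj e v k)%R) //.
rewrite [RHS](big_setID X) /= (setIidPr sXW).
rewrite [X in (_ + X)%R]big1 ?GRing.addr0 => [|k]; last first.
  by rewrite !inE => /andP[+ Wk]; rewrite Wk negbK => /eqP->; rewrite GRing.mul0r.
apply: eq_bigr => k; rewrite inE => /andP[/c01].
by rewrite !inE => /orP[->|/eqP-> _] //; rewrite GRing.mul1r.
Qed.

Lemma sober_witness (X : {set T}) :
  simple_graph e -> sober e -> X != set0 -> #|X| <= 2 ->
  exists v, #|X :\: star e v| = 1.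
Proof.
move=> [sym irr] sob; rewrite -card_gt0 => X_gt0 X_le2.
have [/eqP/cards1P[x ->] | X_neq1] := eqVneq #|X| 1.
  exists x; rewrite (_ : _ :\: _ = [set x]) ?cards1 //.
  by apply/setP => y; rewrite !inE; case: eqP => [->|]; rewrite ?irr ?andbF.
have /cards2P[x [y [neq_xy ->]]] : #|X| == 2 by case: #|X| X_gt0 X_le2 X_neq1 => [|[|[]]].
have [v neq_v] : exists v, e x v != e y v.
  apply/existsP; apply: contraNT neq_xy; rewrite negb_exists => /forallP eq_v.
  by apply/eqP/sob/setP => v; rewrite !inE; apply/eqP/negPn/eq_v.
exists v; apply/eqP/cards1P.
(* Exactly one of [x], [y] is adjacent to [v]; the other one is what remains. *)
case exv: (e x v) neq_v => eyv; [exists y | exists x]; apply/setP => z.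
  rewrite !inE; have [->|_] := eqVneq z x; last first.
    by have [->|] := eqVneq z y; rewrite ?andbF // sym; case: (e y v) eyv.
  by rewrite sym exv (negPf neq_xy).
rewrite !inE; have [->|_] := eqVneq z x; first by rewrite sym exv.
by have [->|] := eqVneq z y; rewrite ?andbF // sym; case: (e y v) eyv.
Qed.

Lemma c_independentU1 (W : {set T}) (u : T) :
  simple_graph e -> u \in star_set e W -> c_independent e W ->
  c_independent e (u |: W).
Proof.
move=> [sym irr] /bigcapP Wu /c_independentP witW.
apply/c_independentP => X sXuW X_n0.
have [Xu | X'u] := boolP (u \in X); last first.
  apply: witW X_n0; apply/subsetP => x Xx.
  by have /setU1P[xu|//] := subsetP sXuW x Xx; rewrite -xu Xx in X'u.
exists u; apply/eqP/cards1P; exists u; apply/setP => x; rewrite !inE.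
have [->|neq_xu] := eqVneq x u; first by rewrite irr Xu.
apply/negP => /andP[nux /(subsetP sXuW)]; rewrite !inE (negPf neq_xu) /= => /Wu.
by rewrite inE sym (negPf nux).
Qed.

End CIndependence.

Theorem theorem5p3 (T : finType) (e : rel T) (W : {set T}) :
  simple_graph e -> sober e -> connected_graph e -> c_rank e = 3 ->
  (c_independent e W <->
     (#|W| <= 2 \/
      [/\ #|W| = 3, star_set e W = set0 & ~ potential_line e W])).
Proof.
move=> sg sob _ rk3.
have le3 (U : {set T}) : c_independent e U -> #|U| <= 3.
  by move=> indU; rewrite -rk3 /c_rank (bigmax_sup U).
split=> [indW | [W_le2 | [W3 StW nplW]]].
- have [|W_gt2] := leqP #|W| 2; [by left | right].
  have W3 : #|W| = 3 by apply/eqP; rewrite eqn_leq le3.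
  split=> // [|[_ plW]].
    apply/eqP; apply: contraT => /set0Pn[u Wu].
    (* There are no loops, so [u] lies outside [W] and [u |: W] would be c-independent of size 4. *)
    have /le3 := c_independentU1 _ _ _ _ sg Wu indW; rewrite cardsU1 W3.
    suff -> : u \notin W by [].
    by apply/negP => /(bigcapP Wu); rewrite inE sg.2.
  (* A witness for [W] itself is adjacent to two of its three elements, which no potential line
     allows. *)
  have [||v] := c_independentP _ _ _ indW W => //.
    by rewrite -card_gt0 W3.
  move=> W1; have := cardsID (star e v) W.
  by rewrite W3 W1 addn1 => -[/esym Wv]; have := plW v; rewrite -Wv.
- apply/c_independentP => X sXW X_n0; apply: sober_witness => //.
  exact: leq_trans (subset_leq_card sXW) W_le2.
apply/c_independentP => X sXW X_n0.
have [|X_gt2] := leqP #|X| 2; first exact: sober_witness.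
have -> : X = W by apply/eqP; rewrite eqEcard sXW W3.
(* As [W] has three elements, it fails to be a potential line only through such a [v]. *)
have [v Wv] : exists v, 1 < #|W :&: star e v|.
  apply/existsP; apply: contra_notT nplW; rewrite negb_exists => /forallP plW.
  by split=> // v; rewrite leqNgt.
exists v; have := cardsID (star e v) W; rewrite W3.
(* At most one element of [W] is not adjacent to [v]. There is one, since otherwise [v] would lie in
   the empty [star_set e W]. *)
suff : 0 < #|W :\: star e v|.
  by case: #|W :&: _| Wv => [|[|m]] // _; case: #|_| => [|[|k]] // _;
     rewrite !addSn !addnS.
rewrite card_gt0 setD_eq0; apply/negP => /subsetP WSv.
have : v \in star_set e W by apply/bigcapP => w /WSv; rewrite !inE sg.1.
by rewrite StW inE.
Qed.
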